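(* Let $\tau$ be a complex number with $\mathrm{Im}(\tau)>0$ and let $q=e^{\pi i\tau}$. For every integer $n\ge 2$, \[ P_q(n):=\prod_{\substack{k=1\\ \gcd(k,n)=1}}^{n}\Gamma_q\Big(\frac{k}{n}\Big) = \frac{ \left(\Gamma_q\big( \tfrac{1}{2} \big)\right)^{\varphi(n)} (q^{\frac{1}{2}};q)_\infty^{\varphi(n)}} { \prod_{d\mid n}\big( f(- q^{\frac{1}{d}}) \big)^{\mu\left(\frac{n}{d}\right)}} = \frac{\left( 2\,\Gamma_q\big(\tfrac{1}{2}\big)^2\right)^{\frac{\varphi(n)}{2}}}{e^{\frac{\Lambda_q(n)}{2}}}. \]
   Context: For a complex number $a$ and $|p|<1$, $(a;p)_\infty=\prod_{i=0}^{\infty}(1-ap^i)$. Fractional powers of $q$ are defined via $\tau$: $q^{c}=e^{\pi i\tau c}$ for real $c$. Ramanujan's function $f$ is given by $f(-p)=(p;p)_\infty$, so $f(-q^{1/d})=(q^{1/d};q^{1/d})_\infty$. The $q$-gamma function is $\Gamma_q(z)=\dfrac{(q;q)_\infty}{(q^{z};q)_\infty}(1-q)^{1-z}$, with the principal branch for $(1-q)^{1-z}$. $\varphi$ is Euler's totient function and $\mu$ the Möbius function. The $q$-von Mangoldt function is $\Lambda_q(n)=\log \dfrac{ 2^{\varphi(n)}\prod_{d\mid n} \big(f(-q^{\frac{1}{d}})\big)^{2\mu\left(\frac{n}{d}\right)} }{(q^{\frac{1}{2}};q)_{\infty}^{2\varphi(n)} }$, and here $e^{\Lambda_q(n)/2}$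 is understood as the square root $2^{\varphi(n)/2}\prod_{d\mid n} \big(f(-q^{\frac{1}{d}})\big)^{\mu\left(\frac{n}{d}\right)}\big/(q^{\frac{1}{2}};q)_{\infty}^{\varphi(n)}$ (with $2^{\varphi(n)/2}>0$); for real $0<q<1$ this agrees with the real logarithm. *)

(* Defs.v *)
From HB Require Import structures.
From mathcomp Require Export all_boot all_order all_algebra.
From mathcomp Require Export all_classical all_reals all_analysis.
From mathcomp Require Export complex.

Set Implicit Arguments.
Unset Strict Implicit.
Unset Printing Implicit Defensive.

Export Order.TTheory GRing.Theory Num.Theory.
Export numFieldNormedType.Exports.

Local Open Scope classical_set_scope.
Local Open Scope ring_scope.
Local Open Scope complex_scope.

Local Notation normc := ComplexField.Normc.normc.

Section ComplexElementary.
Variable R : realType.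
Implicit Types w z : R[i].

Definition cexp z : R[i] :=
  (expR (complex.Re z) * cos (complex.Im z))
    +i* (expR (complex.Re z) * sin (complex.Im z)).

(* Principal argument, with values in ]-pi, pi] for w != 0. *)
Definition carg w : R :=
  if 0 <= complex.Im w then acos (complex.Re w / normc w)
  else - acos (complex.Re w / normc w).

Definition clog w : R[i] := ln (normc w) +i* carg w.

(* Principal branch of w ^ z, meaningful for w != 0. *)
Definition cpow w z : R[i] := cexp (z * clog w).

End ComplexElementary.

Definition mobius (n : nat) : int :=
  if all (fun p => logn p n == 1%N) (primes n) then (-1) ^+ size (primes n)
  else 0.

(* (a; p)_oo *)
Definition qpoch (C : numFieldType) (a p : C) : C :=
  limn (fun N : nat => \prod_(0 <= i < N) (1 - a * p ^+ i)).

Section QFunctions.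
Variable R : realType.
Implicit Types s z tau : R[i].

(* q ^ z, so that q itself is qexp tau 1. *)
Definition qexp tau z : R[i] := cexp ((pi : R)%:C * 'i * tau * z).

Definition ramanujan_f z : R[i] := qpoch (- z) (- z).

Definition qgamma tau z : R[i] :=
  let q := qexp tau 1 in
  qpoch q q / qpoch (qexp tau z) q * cpow (1 - q) (1 - z).

Definition Pq tau (n : nat) : R[i] :=
  \prod_(1 <= k < n.+1 | coprime k n) qgamma tau (k%:R / n%:R).

(* (2 s ^ 2) ^ (m / 2) for the square root 2 ^ (1 / 2) s of 2 s ^ 2. For odd m
   the principal square root would not do: the real part of
   Gamma_q (1 / 2) may be negative for complex q. *)
Definition half_pow s (m : nat) : R[i] := (Num.sqrt (2 : R))%:C ^+ m * s ^+ m.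

(* The quantity whose logarithm is Lambda_q (n). *)
Definition Lambda_arg tau (n : nat) : R[i] :=
  2 ^+ totient n
  * (\prod_(d <- divisors n)
       ramanujan_f (- qexp tau d%:R^-1) ^ (2 * mobius (n %/ d)))
  / qpoch (qexp tau 2^-1) (qexp tau 1) ^+ (2 * totient n).

(* exp (Lambda_q (n) / 2), as a specified square root of Lambda_arg tau n. *)
Definition exp_half_Lambda tau (n : nat) : R[i] :=
  (Num.sqrt (2 : R))%:C ^+ totient n
  * (\prod_(d <- divisors n)
       ramanujan_f (- qexp tau d%:R^-1) ^ mobius (n %/ d))
  / qpoch (qexp tau 2^-1) (qexp tau 1) ^+ totient n.

Lemma sqrt2C_sqr : (Num.sqrt (2 : R))%:C ^+ 2 = 2 :> R[i].
Proof. by rewrite -rmorphXn /= sqr_sqrtr ?ler0n// rmorph_nat. Qed.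

Lemma half_pow_sqr s m : half_pow s m ^+ 2 = (2 * s ^+ 2) ^+ m.
Proof. by rewrite /half_pow exprMn !(exprAC _ m 2) sqrt2C_sqr -exprMn. Qed.

Lemma half_pow_double s m : half_pow s m.*2 = (2 * s ^+ 2) ^+ m.
Proof. by rewrite /half_pow -mul2n !(exprM _ 2 m) sqrt2C_sqr -exprMn. Qed.

Lemma exp_half_Lambda_sqr tau n :
  exp_half_Lambda tau n ^+ 2 = Lambda_arg tau n.
Proof.
rewrite /exp_half_Lambda /Lambda_arg exprMn exprVn -exprM [in RHS]mulnC.
congr (_ / _); rewrite exprMn exprAC sqrt2C_sqr; congr (_ * _).
rewrite -prodrXl; apply: eq_bigr => d _.
by rewrite mulrC -exprz_exp.
Qed.

End QFunctions.

(* Main.v *)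
Require Import Defs.
From mathcomp Require Import ring lra.

(* For |p| < 1, splitting the factors of (p; p)_oo by exponent modulo m gives
   (p; p)_oo = prod_(1 <= k <= m) (p ^ k; p ^ m)_oo. With p = q ^ (1 / m),
   f (- q ^ (1 / m)) is the product of the (q ^ (k / m); q)_oo for
   1 <= k <= m. Writing k / m in lowest terms, this is the product over e | m
   of the products over j coprime to e of (q ^ (j / e); q)_oo, and Moebius
   inversion isolates the factor e = n. The powers of 1 - q match because
   k -> n - k shows that the k coprime to n have mean n / 2. *)

Set Implicit Arguments.
Unset Strict Implicit.
Unset Printing Implicit Defensive.

Local Open Scope classical_set_scope.
Local Open Scope ring_scope.
Local Open Scope complex_scope.

Local Notation normc := ComplexField.Normc.normc.

(** * Infinite products in R[i] *)

Section ComplexProducts.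
Variable R : realType.
Local Notation C := (R[i] : numFieldType).
Implicit Types (u : nat -> C) (l a p : C).

Lemma normcEr (z : R[i]) : `|z| = (normc z)%:C.
Proof. by []. Qed.

Lemma cvg_complex u l :
  complex.Re (u n) @[n --> \oo] --> complex.Re l ->
  complex.Im (u n) @[n --> \oo] --> complex.Im l ->
  u @ \oo --> l.
Proof.
move=> /cvgrPdist_lt cRe /cvgrPdist_lt cIm; apply/cvgrPdist_lt => e e0.
(* In the order of [R[i]], a positive [e] is real, so the estimate reduces to real numbers. *)
have /andP[/eqP Ie Re0] : (complex.Im e == 0) && (0 < complex.Re e).
  by move: e0; rewrite ltcE.
have -> : e = (complex.Re e)%:C by rewrite [LHS]complexE Ie mulr0 addr0.
have h0 : 0 < complex.Re e / 2 by rewrite divr_gt0.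
near=> n.
rewrite normcEr ltcR.
have -> : l - u n = (complex.Re l - complex.Re (u n))%:C
    + 'i * (complex.Im l - complex.Im (u n))%:C.
  by rewrite [LHS]complexE; case: (l) (u n) => [x y] [z t].
apply: (le_lt_trans (le_normcD _ _)); rewrite (splitr (complex.Re e)) ltrD//.
  rewrite -ltcR -normcEr normc_def /= expr0n /= addr0 sqrtr_sqr ltcR.
  by near: n; exact: cRe.
rewrite -ltcR -normcEr normrM !normc_def /= !expr0n /= !addr0 add0r expr1n.
rewrite sqrtr1 mul1r sqrtr_sqr ltcR.
by near: n; exact: cIm.
Unshelve. all: by end_near. Qed.

(** The real and imaginary parts are additive and bounded by the modulus, so each gives a real
    series dominated by [v]. *)
Lemma is_cvg_complex_series u (v : nat -> R) :
  (forall i, normc (u i) <= v i) -> cvgn (series v) -> cvgn (series u).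
Proof.
move=> uv cv.
have v0 i : 0 <= v i.
  by apply: le_trans (uv i); rewrite -ler0c -normcEr normr_ge0.
(* [f] stands for the real part and then for the imaginary part. *)
have part (f : R[i] -> R) : {morph f : x y / x + y} -> f 0 = 0 ->
    (forall z, `|f z| <= normc z) -> cvgn (fun n => f (series u n)).
  move=> fD f0 fle.
  have -> : (fun n => f (series u n)) = series (f \o u).
    by apply/funext => n; rewrite /series /= (big_morph f fD f0).
  apply: normed_cvg; apply: series_le_cvg cv => [n|//|n] /=; first exact: normr_ge0.
  exact: (le_trans (fle (u n)) (uv n)).
have cRe : cvgn (fun n => complex.Re (series u n)).
  apply: part => // [[? ?] [? ?]//|[x y]/=].
  by rewrite -sqrtr_sqr ler_wsqrtr// lerDl sqr_ge0.
have cIm : cvgn (fun n => complex.Im (series u n)).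
  apply: part => // [[? ?] [? ?]//|[x y]/=].
  by rewrite -sqrtr_sqr ler_wsqrtr// lerDr sqr_ge0.
apply/cvg_ex; exists (limn (fun n => complex.Re (series u n))
  +i* limn (fun n => complex.Im (series u n))).
exact: cvg_complex.
Qed.

(** The partial products telescope: P (N + 1) - P N = P N * u N. Once the P N are bounded, these
    increments are dominated by a geometric series. *)
Lemma is_cvg_complex_prod u (c r : R) : 0 <= r < 1 ->
  (forall i, normc (u i) <= c * r ^+ i) ->
  cvgn (fun N => \prod_(0 <= i < N) (1 + u i) : C).
Proof.
move=> /andP[r0 r1] uc; set P := fun N => _.
have c0 : 0 <= c.
  have := uc 0%N; rewrite expr0 mulr1; apply: le_trans.
  by rewrite -ler0c -normcEr.
have -> : P = (fun N => 1 + series (fun i => P i * u i) N).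
  apply/funext; elim=> [|N IH]; first by rewrite /P seriesEnat /= !big_geq ?addr0.
  by rewrite seriesSr addrA -IH /P big_nat_recr //= mulrDr mulr1.
apply: is_cvgD; first exact: is_cvg_cst.
(* By 1 + x <= exp x on each factor, |P N| is at most the exponential of c times a partial geometric
   sum, and that sum is at most 1 / (1 - r). *)
pose M := expR (c / (1 - r)).
have PM N : normc (P N) <= M.
  have : normc (P N) <= expR (c * \sum_(0 <= i < N) r ^+ i).
    elim: N => [|N IH].
      by rewrite /P !big_geq// mulr0 expR0 -lecR -normcEr normr1.
    rewrite /P !big_nat_recr//= -/(P N) (mulrDr c) expRD.
    rewrite ComplexField.Normc.normcM ler_pM//.
    - by rewrite -ler0c -normcEr.
    - by rewrite -ler0c -normcEr.
    - apply: le_trans (expR_ge1Dx _); apply: (le_trans (le_normcD _ _)).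
      by rewrite ComplexField.Normc.normc1 lerD2l.
  move/le_trans; apply; rewrite ler_expR ler_wpM2l//.
  rewrite -[leRHS]mul1r ler_pdivlMr ?subr_gt0// mulrC.
  have -> : (1 - r) * \sum_(0 <= i < N) r ^+ i = 1 - r ^+ N.
    by rewrite -opprB mulNr big_mkord -subrX1 opprB.
  by rewrite gerBl exprn_ge0.
apply: (@is_cvg_complex_series _ (geometric (M * c) r)).
  move=> i; rewrite ComplexField.Normc.normcM /geometric /= -mulrA.
  by rewrite ler_pM// -ler0c -normcEr.
by apply: is_cvg_geometric_series; rewrite ger0_norm.
Qed.

End ComplexProducts.

Lemma cvg_prod (K : numFieldType) (I : eqType) (s : seq I)
    (f : I -> nat -> K) (l : I -> K) :
  (forall i, i \in s -> f i @ \oo --> l i) ->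
  (fun N => \prod_(i <- s) f i N) @ \oo --> \prod_(i <- s) l i.
Proof.
elim: s => [|i s IH] fl.
  by under eq_fun do rewrite big_nil; rewrite big_nil; exact: cvg_cst.
under eq_fun do rewrite big_cons; rewrite big_cons.
apply: cvgM; first by apply: fl; rewrite mem_head.
by apply: IH => j js; apply: fl; rewrite inE js orbT.
Qed.

Lemma cvg_mulnr_infty (m : nat) : (0 < m)%N -> (fun N => (N * m)%N) @ \oo --> \oo.
Proof.
move=> m0 A [N _ NA]; exists N => // i /= Ni; apply: NA => /=.
exact: leq_trans (leq_pmulr _ m0).
Qed.

(** * Convergence, nonvanishing and multisection of (a; p)_oo *)

Section QPochhammer.
Variable R : realType.
Implicit Types (a p : R[i]).

Lemma normr_lt1E a : (`|a| < 1) = (normc a < 1).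
Proof. by rewrite normcEr ltcR. Qed.

Lemma normc_ge0 a : 0 <= normc a.
Proof. by rewrite -ler0c -normcEr. Qed.

Lemma normcX a n : normc (a ^+ n) = normc a ^+ n.
Proof.
elim: n => [|n IH]; first by rewrite !expr0 ComplexField.Normc.normc1.
by rewrite !exprS ComplexField.Normc.normcM IH.
Qed.

Lemma is_cvg_qpoch a p : `|p| < 1 ->
  cvgn (fun N => \prod_(0 <= i < N) (1 - a * p ^+ i) : (R[i] : numFieldType)).
Proof.
rewrite normr_lt1E => p1.
apply: (@is_cvg_complex_prod _ (fun i => - (a * p ^+ i)) (normc a) (normc p)).
  by rewrite normc_ge0.
by move=> i; rewrite normcN ComplexField.Normc.normcM normcX.
Qed.

Lemma cvg_qpoch a p : `|p| < 1 ->
  (fun N => \prod_(0 <= i < N) (1 - a * p ^+ i) : (R[i] : numFieldType)) @ \oo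
    --> (qpoch a p : (R[i] : numFieldType)).
Proof. exact: is_cvg_qpoch. Qed.

(* The partial products of the reciprocals 1 / (1 - x) = 1 + x / (1 - x)
   converge as well, so the limit has an inverse. *)
Lemma qpoch_neq0 a p : `|a| < 1 -> `|p| < 1 -> qpoch a p != 0.
Proof.
move=> a1 p1.
have le1 i : `|a * p ^+ i| <= `|a|.
  by rewrite normrM normrX ler_piMr// exprn_ile1// ltW.
have den_neq0 i : 1 - a * p ^+ i != 0.
  rewrite subr_eq0 eq_sym; apply: contraTneq (le_lt_trans (le1 i) a1) => ->.
  by rewrite normr1 ltxx.
pose u i : R[i] := a * p ^+ i / (1 - a * p ^+ i).
have cu : cvgn (fun N => \prod_(0 <= i < N) (1 + u i) : (R[i] : numFieldType)).
  (* The constant comes from |1 - a p^i| >= 1 - |a p^i| >= 1 - |a|. *)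
  apply: (@is_cvg_complex_prod _ u (normc a / (1 - normc a)) (normc p)).
    by rewrite normc_ge0 -normr_lt1E.
  move=> i; rewrite /u !(ComplexField.Normc.normcM, ComplexField.Normc.normcV) normcX.
  rewrite [leRHS]mulrAC ler_wpM2l ?mulr_ge0 ?exprn_ge0 ?normc_ge0//.
  rewrite lef_pV2 ?posrE.
  - rewrite -lecR rmorphB -!normcEr rmorph1.
    rewrite lerBlDr; apply: le_trans (_ : `|1 - a * p ^+ i| + `|a * p ^+ i| <= _).
      by rewrite -[leLHS]normr1 -{1}[1](subrK (a * p ^+ i)) ler_normD.
    by rewrite lerD2l.
  - by rewrite -ltcR -normcEr normr_gt0.
  - by rewrite subr_gt0 -normr_lt1E.
have inv N : (\prod_(0 <= i < N) (1 - a * p ^+ i)) * \prod_(0 <= i < N) (1 + u i) = 1.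
  rewrite -big_split /= big1// => i _; rewrite /u.
  by rewrite mulrDr mulr1 mulrCA divff// mulr1 subrK.
apply: contra_neq (@oner_neq0 R[i]) => q0.
have := cvgM (cvg_qpoch (a := a) p1) cu; rewrite q0 mul0r.
rewrite (_ : _ \* _ = cst 1); last by apply/funext => N; exact: inv.
move=> L; exact: (cvg_unique (@norm_hausdorff _ _) (cvg_cst _) (L _)).
Qed.

(** Each exponent in 1, ..., N m is uniquely k + m i with 1 <= k <= m and i < N, which gives an
    identity of finite products. In the limit, the left side runs along the subsequence N m of its
    partial products. *)
Lemma qpoch_multisection p (m : nat) : `|p| < 1 -> (0 < m)%N ->
  qpoch p p = \prod_(1 <= k < m.+1) qpoch (p ^+ k) (p ^+ m).
Proof.
move=> p1 m0.
have pm1 : `|p ^+ m| < 1 by rewrite normrX exprn_ilt1// -lt0n.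
have finite N : \prod_(0 <= i < N * m) (1 - p * p ^+ i) =
    \prod_(1 <= k < m.+1) \prod_(0 <= i < N) (1 - p ^+ k * (p ^+ m) ^+ i).
  elim: N => [|N IH].
    by rewrite mul0n big_geq// big1// => k _; rewrite big_geq.
  under [RHS]eq_bigr do rewrite big_nat_recr//=.
  (* Passing from N to N + 1 adds the exponents N m + 1, ..., N m + m, one for each k. *)
  rewrite big_split -IH mulSn addnC (@big_cat_nat _ _ _ (N * m))//= ?leq_addr//.
  congr (_ * _); rewrite big_add1 -{1}[(N * m)%N]add0n big_addn addKn.
  by apply: eq_bigr => i _; rewrite -exprS -exprM -exprD addSn mulnC.
have L := cvg_comp _ _ (cvg_mulnr_infty m0) (cvg_qpoch (a := p) p1).
have R' := @cvg_prod (R[i] : numFieldType) _ (index_iota 1 m.+1)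
  (fun k N => \prod_(0 <= i < N) (1 - p ^+ k * (p ^+ m) ^+ i))
  (fun k => qpoch (p ^+ k) (p ^+ m)) (fun k _ => cvg_qpoch (a := p ^+ k) pm1).
apply: (cvg_unique (@norm_hausdorff _ _) L).
by move: R'; under eq_fun do rewrite -finite.
Qed.

End QPochhammer.

(** * The complex exponential and the powers of q *)

Section QExp.
Variable R : realType.
Implicit Types (w z tau : R[i]).

Lemma cexpD w z : cexp (w + z) = cexp w * cexp z.
Proof.
case: w z => [a b] [c d]; rewrite /cexp /= expRD cosD sinD; apply/eqP.
by rewrite eq_complex /=; apply/andP; split; apply/eqP; ring.
Qed.

Lemma cexp0 : cexp 0 = 1 :> R[i].
Proof. by rewrite /cexp /= expR0 cos0 sin0 mulr1 mulr0. Qed.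

Lemma cexp_sum (I : Type) (s : seq I) (P : pred I) (F : I -> R[i]) :
  cexp (\sum_(i <- s | P i) F i) = \prod_(i <- s | P i) cexp (F i).
Proof. exact: (big_morph _ cexpD cexp0). Qed.

Lemma cexpMn z n : cexp (z *+ n) = cexp z ^+ n.
Proof. by elim: n => [|n IH]; rewrite ?cexp0// mulrS cexpD IH exprS. Qed.

Lemma normr_cexp z : `|cexp z| = (expR (complex.Re z))%:C.
Proof.
rewrite normc_def /cexp /= !exprMn -mulrDr cos2Dsin2 mulr1 sqrtr_sqr.
by rewrite ger0_norm ?expR_ge0.
Qed.

Lemma qexpMn tau z n : qexp tau (z *+ n) = qexp tau z ^+ n.
Proof. by rewrite /qexp mulrnAr cexpMn. Qed.

(** The modulus is exp (- pi x Im tau), and the exponent is negative. *)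
Lemma normr_qexp_lt1 tau (x : R) : 0 < complex.Im tau -> 0 < x ->
  `|qexp tau x%:C| < 1.
Proof.
move=> t0 x0; rewrite normr_cexp -[1](rmorph1 (real_complex R)) ltcR.
rewrite -expR0 ltr_expR; case: tau t0 => a b /= b0.
have : 0 < pi * b * x by rewrite !mulr_gt0// pi_gt0.
by set t := pi; nra.
Qed.

End QExp.

(** * Moebius inversion *)

Lemma mobius1 : mobius 1 = 1.
Proof. by []. Qed.

(** If p divides b, then p occurs at least twice in p b. Otherwise p b has exactly one more prime,
    with exponent 1, and the other exponents do not change. *)
Lemma mobius_primeM p b : prime p -> (0 < b)%N ->
  mobius (p * b) = if (p %| b)%N then 0 else - mobius b.
Proof.
move=> pp b0; have p0 := prime_gt0 pp.
have pb0 : (0 < p * b)%N by rewrite muln_gt0 p0.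
have [pb|npb] := boolP (p %| b)%N.
  rewrite /mobius ifF//; apply/negbTE/allPn; exists p.
    by rewrite mem_primes pp pb0 dvdn_mulr.
  rewrite lognM// logn_prime// eqxx add1n eqSS -lt0n.
  by rewrite logn_gt0 mem_primes pp b0.
have pprim : perm_eq (primes (p * b)) (p :: primes b).
  apply: uniq_perm; rewrite ?primes_uniq//=.
    by rewrite primes_uniq mem_primes (negPf npb) !andbF.
  by move=> x; rewrite primesM// primes_prime// !inE.
rewrite /mobius (perm_all _ pprim) (perm_size pprim) /= exprS mulN1r.
have -> : logn p (p * b) == 1%N.
  by rewrite lognM// logn_prime// eqxx (lognE p b) (negPf npb) !andbF.
rewrite [in RHS](fun_if -%R) oppr0 /=; congr (if _ then _ else _).
apply: eq_in_all => x xb; rewrite lognM// logn_prime//.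
case: (x =P p) => [xp|//]; move: xb; rewrite xp mem_primes.
by rewrite (negPf npb) !andbF.
Qed.

(** For m > 1, fix a prime p dividing m. The divisors p b with p not dividing b cancel the divisors
    prime to p, and those with p dividing b contribute 0. *)
Lemma sum_mobius_divisors m : (0 < m)%N ->
  \sum_(d <- divisors m) mobius d = (m == 1%N)%:R.
Proof.
move=> m0; case: eqVneq => [->|m1]; first by rewrite big_seq1.
have m_gt1 : (1 < m)%N by rewrite ltn_neqAle eq_sym m1.
set p := pdiv m; have pp : prime p := pdiv_prime m_gt1.
have p0 := prime_gt0 pp.
have pm : (p %| m)%N := pdiv_dvd m.
have mp0 : (0 < m %/ p)%N by rewrite divn_gt0// dvdn_leq.
rewrite (bigID (fun d => p %| d)%N) /=.
have -> : \sum_(d <- divisors m | (p %| d)%N) mobius d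
    = \sum_(b <- divisors (m %/ p)) mobius (p * b).
  rewrite -big_filter -(big_map (muln p) predT mobius).
  apply: perm_big; apply: uniq_perm.
  - by rewrite filter_uniq// divisors_uniq.
  - rewrite map_inj_uniq ?divisors_uniq// => x y /eqP.
    by rewrite eqn_pmul2l// => /eqP.
  move=> x; rewrite mem_filter -dvdn_divisors//.
  apply/andP/mapP => [[/dvdnP[b ->] bm]|[b]].
    exists b; last by rewrite mulnC.
    by rewrite -dvdn_divisors// dvdn_divRL//.
  rewrite -dvdn_divisors// dvdn_divRL// => bm ->.
  by split; [exact: dvdn_mulr | rewrite mulnC].
have -> : \sum_(b <- divisors (m %/ p)) mobius (p * b)
    = \sum_(b <- divisors (m %/ p)) (if (p %| b)%N then 0 else - mobius b).
  apply: eq_big_seq => b; rewrite -dvdn_divisors// => bm.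
  by rewrite mobius_primeM// (dvdn_gt0 mp0).
rewrite (bigID (fun d => p %| d)%N) /= big1 ?add0r; last by move=> b ->.
under eq_bigr => b npb do rewrite (negPf npb).
rewrite sumrN addrC; apply/eqP; rewrite subr_eq0; apply/eqP.
rewrite -[LHS]big_filter -[RHS]big_filter; apply: perm_big; apply: uniq_perm.
- by rewrite filter_uniq// divisors_uniq.
- by rewrite filter_uniq// divisors_uniq.
(* An x prime to p divides m exactly when it divides m / p, so both sums run over the same
   divisors. *)
move=> x; rewrite !mem_filter -!dvdn_divisors//.
have [//|npx] /= := boolP (p %| x)%N.
rewrite -{1}(divnK pm) Gauss_dvdl//.
by rewrite coprime_sym prime_coprime.
Qed.

Section Inversion.
Variable F : fieldType.

Lemma prodr_exprz (I : Type) (s : seq I) (P : pred I) (f : I -> F) (k : int) :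
  \prod_(i <- s | P i) f i ^ k = (\prod_(i <- s | P i) f i) ^ k.
Proof.
by rewrite (big_morph (fun x : F => x ^ k) (fun x y => expfzMl x y k) (exp1rz F k)).
Qed.

Lemma exprz_sum (I : Type) (s : seq I) (P : pred I) (x : F) (k : I -> int) :
  x != 0 -> \prod_(i <- s | P i) x ^ k i = x ^ (\sum_(i <- s | P i) k i).
Proof.
move=> x0; rewrite (big_morph (fun k : int => x ^ k) (id1 := 1) (op1 := *%R))//.
by move=> a b; rewrite expfzDr.
Qed.

(** After exchanging the products, [g e] has as exponent the sum of mu (n / d) over e | d | n, which
    is zero unless e = n. Since [g e] is nonzero, exponents of either sign can be added. *)
Lemma prod_mobius_inversion (f g : nat -> F) n : (0 < n)%N ->
  (forall d, (d %| n)%N -> g d != 0) ->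
  (forall d, (d %| n)%N -> f d = \prod_(e <- divisors d) g e) ->
  \prod_(d <- divisors n) f d ^ mobius (n %/ d) = g n.
Proof.
move=> n0 g0 fg.
have dn d : d \in divisors n = (d %| n)%N by rewrite -dvdn_divisors.
transitivity (\prod_(d <- divisors n) \prod_(e <- divisors n | (e %| d)%N)
    g e ^ mobius (n %/ d)).
  apply: eq_big_seq => d; rewrite dn => dvd; rewrite fg// -prodr_exprz.
  rewrite -[RHS]big_filter; apply: perm_big; apply: uniq_perm.
  - exact: divisors_uniq.
  - by rewrite filter_uniq// divisors_uniq.
  move=> e; rewrite mem_filter dn -dvdn_divisors ?(dvdn_gt0 n0)//.
  by apply/idP/andP => [ed|[]//]; split=> //; apply: dvdn_trans dvd.
rewrite (exchange_big_dep predT) //= (big_rem n) /=; last by rewrite dn.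
rewrite [X in _ * X]big_seq [X in _ * X]big1 ?mulr1.
  (* For e = n the only d is n itself, with exponent mu (1) = 1. *)
  rewrite -big_filter (perm_big [:: n]).
    by rewrite big_seq1 divnn n0 mobius1 expr1z.
  apply: uniq_perm; rewrite ?filter_uniq ?divisors_uniq// => x.
  by rewrite mem_filter dn inE -eqn_dvd eq_sym.
move=> e; rewrite mem_rem_uniq ?divisors_uniq// inE dn => /andP[en edn].
have e0 := dvdn_gt0 n0 edn.
have ne0 : (0 < n %/ e)%N by rewrite divn_gt0// dvdn_leq.
rewrite exprz_sum ?g0//.
suff -> : \sum_(d <- divisors n | (e %| d)%N) mobius (n %/ d) = 0 by [].
(* The substitution c = n / d maps the d with e | d | n bijectively onto the divisors of n / e. *)
transitivity (\sum_(c <- divisors (n %/ e)) mobius c); last first.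
  rewrite sum_mobius_divisors// -(eqn_pmul2l e0) [(e * _)%N]mulnC divnK// muln1 eq_sym.
  by rewrite (negPf en).
rewrite -big_filter -(big_map (fun d => n %/ d)%N predT mobius).
apply: perm_big; apply: uniq_perm; rewrite ?divisors_uniq//.
  rewrite map_inj_in_uniq ?filter_uniq ?divisors_uniq// => x y.
  rewrite !mem_filter !dn => /andP[_ xn] /andP[_ yn] xy.
  have nx0 : (0 < n %/ x)%N by rewrite divn_gt0 ?(dvdn_leq n0 xn) ?(dvdn_gt0 n0 xn).
  by apply/eqP; rewrite -(eqn_pmul2l nx0) {2}xy !divnK.
move=> c; rewrite -dvdn_divisors//; apply/mapP/idP => [[d]|cn].
  rewrite mem_filter dn => /andP[ed dvn] ->.
  rewrite dvdn_divRL// -[X in (_ %| X)%N](divnK dvn) dvdn_pmul2l//.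
  by rewrite divn_gt0 ?(dvdn_leq n0 dvn) ?(dvdn_gt0 n0 dvn).
have c_n : (c %| n)%N by apply: dvdn_trans cn (dvdn_div edn).
exists (n %/ c)%N; last by rewrite divnA// mulnC mulnK.
rewrite mem_filter dn dvdn_div// andbT dvdn_divRL//.
by rewrite mulnC -dvdn_divRL.
Qed.

End Inversion.

(* Each k in {1, ..., n} is (n / e) * j, where j / e is k / n in lowest terms. *)
Lemma perm_iota_divisors n : (0 < n)%N ->
  perm_eq (index_iota 1 n.+1)
    [seq (n %/ e * j)%N | e <- divisors n,
       j <- [seq j <- index_iota 1 e.+1 | coprime j e]].
Proof.
move=> n0; apply: uniq_perm; first exact: iota_uniq.
  apply: allpairs_uniq_dep => [|e _|]; rewrite ?divisors_uniq ?filter_uniq ?iota_uniq//.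
  move=> _ _ /allpairsPdep[e [j [eD jD ->]]] /allpairsPdep[e' [j' [e'D j'D ->]]] /=.
  move: eD e'D jD j'D; rewrite -!dvdn_divisors// !mem_filter !mem_index_iota.
  move=> en e'n /and3P[cj j0 _] /and3P[cj' j'0 _] eq.
  have [e0 e'0] := (dvdn_gt0 n0 en, dvdn_gt0 n0 e'n).
  have ne0 x : (x %| n)%N -> (0 < n %/ x)%N.
    by move=> xn; rewrite divn_gt0 ?(dvdn_leq n0 xn) ?(dvdn_gt0 n0 xn).
  (* The gcd with n recovers n / x from the value (n / x) y, hence the denominator x; this gives
     injectivity. *)
  have h x y : (x %| n)%N -> coprime y x -> gcdn (n %/ x * y) n = (n %/ x)%N.
    move=> xn yx; rewrite -{2}(divnK xn) -muln_gcdr.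
    by rewrite (eqP yx) muln1.
  have ee : e = e'.
    rewrite -(mulKn e (ne0 e en)) -(mulKn e' (ne0 e' e'n)) !divnK//.
    by rewrite -(h e j)// eq h.
  subst e'; congr existT; apply/eqP.
  by rewrite -(eqn_pmul2l (m := n %/ e)) ?eq// divn_gt0// dvdn_leq.
move=> k; rewrite mem_index_iota; apply/idP/allpairsPdep.
  move=> /andP[k0 kn]; set g := gcdn k n.
  have g0 : (0 < g)%N by rewrite gcdn_gt0 k0.
  have [gk gn] : (g %| k)%N /\ (g %| n)%N by rewrite dvdn_gcdl dvdn_gcdr.
  exists (n %/ g)%N, (k %/ g)%N; split.
  - by rewrite -dvdn_divisors// dvdn_div.
  - rewrite mem_filter mem_index_iota divn_gt0// dvdn_leq//= ltnS leq_div2r// andbT.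
    by rewrite /coprime -(eqn_pmul2l g0) muln_gcdr muln1 ![(g * _)%N]mulnC !divnK.
  - by rewrite divnA// mulKn// mulnC divnK.
move=> [e [j [eD]]]; rewrite mem_filter mem_index_iota => /and3P[_ j0 je] ->.
move: eD; rewrite -dvdn_divisors// => en; have e0 := dvdn_gt0 n0 en.
rewrite muln_gt0 j0 divn_gt0// dvdn_leq//= ltnS.
by rewrite -{2}(divnK en) leq_pmul2l// divn_gt0// dvdn_leq.
Qed.

(** * Counting and averaging the integers coprime to n *)

Lemma totient_sum1 n : (1 < n)%N ->
  (\sum_(1 <= k < n.+1 | coprime k n) 1)%N = totient n.
Proof.
move=> n1; rewrite totient_count_coprime big_mkcond big_nat_recr ?(ltnW n1)//=.
(* The ranges 0, ..., n - 1 and 1, ..., n differ only in 0 and n, neither coprime to n because n >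
   1. *)
have cnn : coprime n n = false by rewrite /coprime gcdnn gtn_eqF.
have cn0 : coprime n 0 = false by rewrite /coprime gcdn0 gtn_eqF.
rewrite [in RHS]big_ltn ?(ltnW n1)// cnn cn0 addn0 add0n.
by apply: eq_bigr => k _; rewrite coprime_sym; case: coprime.
Qed.

Lemma sum_coprime n : (1 < n)%N ->
  (\sum_(1 <= k < n.+1 | coprime k n) k).*2 = (totient n * n)%N.
Proof.
move=> n1; rewrite -totient_sum1// big_distrl /=.
under [RHS]eq_bigr do rewrite mul1n.
have ncop0 : coprime 0 n = false by rewrite /coprime gcd0n gtn_eqF.
(* Starting at 0 makes the range symmetric under k -> n - k. *)
have from0 (F : nat -> nat) : (\sum_(1 <= k < n.+1 | coprime k n) F k
    = \sum_(0 <= k < n.+1 | coprime k n) F k)%N.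
  by rewrite [RHS]big_mkcond [RHS]big_ltn//= ncop0 add0n -big_mkcond.
rewrite from0 [RHS]from0.
have refl : (\sum_(0 <= k < n.+1 | coprime k n) k
    = \sum_(0 <= k < n.+1 | coprime k n) (n - k))%N.
  rewrite big_nat_rev /= big_nat_cond [RHS]big_nat_cond.
  apply: eq_big => [k|k _]; last by rewrite add0n subSS.
  have [kn|//] := ltnP k n.+1; congr andb; rewrite add0n subSS.
  (* With a = k and b = n - k, both gcds equal gcd (a, b), so the reflection preserves coprimality
     to n. *)
  have h a b : coprime a (a + b) = coprime b (a + b).
    by rewrite /coprime gcdnDl addnC gcdnDl gcdnC.
  by have := h k (n - k)%N; rewrite subnKC.
rewrite -addnn {2}refl -big_split /= big_nat_cond [RHS]big_nat_cond.
by apply: eq_bigr => k /andP[/andP[_ kn] _]; rewrite subnKC.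
Qed.

(** * Products over reduced fractions *)

Section CoprimeProducts.
Variables (R : realType) (tau : R[i]).
Hypothesis htau : 0 < complex.Im tau.

(** The product of the denominators (q^(j / e); q)_oo of the q-gamma factors of P_q (e). For e = 1
    it is (q; q)_oo, from j = 1. *)
Definition qpoch_coprime (e : nat) : R[i] :=
  \prod_(1 <= j < e.+1 | coprime j e) qpoch (qexp tau (j%:R / e%:R)) (qexp tau 1).

Lemma normr_qexp_ratio_lt1 j e : (0 < j)%N -> (0 < e)%N ->
  `|qexp tau (j%:R / e%:R)| < 1.
Proof.
move=> j0 e0.
have -> : j%:R / e%:R = (j%:R / e%:R : R)%:C by rewrite rmorphM fmorphV !rmorph_nat.
by rewrite normr_qexp_lt1// divr_gt0 ?ltr0n.
Qed.

Lemma normr_nome_lt1 : `|qexp tau 1| < 1.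
Proof. by have := normr_qexp_ratio_lt1 (ltn0Sn 0) (ltn0Sn 0); rewrite divr1. Qed.

Lemma qpoch_ratio_neq0 j e : (0 < j)%N -> (0 < e)%N ->
  qpoch (qexp tau (j%:R / e%:R)) (qexp tau 1) != 0.
Proof.
by move=> j0 e0; rewrite qpoch_neq0 ?normr_nome_lt1 ?normr_qexp_ratio_lt1.
Qed.

Lemma qpoch_coprime_neq0 e : (0 < e)%N -> qpoch_coprime e != 0.
Proof.
move=> e0; rewrite /qpoch_coprime prodf_seq_neq0; apply/allP => j.
rewrite mem_index_iota => /andP[j0 _]; apply/implyP => _.
exact: qpoch_ratio_neq0.
Qed.

Lemma ramanujan_f_prod_divisors d : (0 < d)%N ->
  ramanujan_f (- qexp tau d%:R^-1) = \prod_(e <- divisors d) qpoch_coprime e.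
Proof.
move=> d0; rewrite /ramanujan_f opprK.
have natn0 e : (0 < e)%N -> e%:R != 0 :> R[i] by rewrite pnatr_eq0 -lt0n.
have x1 : `|qexp tau d%:R^-1| < 1.
  by have := normr_qexp_ratio_lt1 (ltn0Sn 0) d0; rewrite div1r.
rewrite (qpoch_multisection x1 d0) -qexpMn -[(_^-1 *+ d)]mulr_natl divff ?natn0//.
rewrite (perm_big _ (perm_iota_divisors d0)) big_allpairs_dep /=.
apply: eq_big_seq => e; rewrite -dvdn_divisors// => ed; rewrite big_filter.
have e0 := dvdn_gt0 d0 ed.
apply: eq_bigr => j _; rewrite -qexpMn -[_^-1 *+ _]mulr_natl natrM.
congr (qpoch (qexp _ _) _); rewrite -{2}(divnK ed) natrM.
have de0 : (d %/ e)%:R != 0 :> R[i] by rewrite natn0// divn_gt0// dvdn_leq.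
by field; rewrite de0 natn0.
Qed.

(** All the powers use the same logarithm [clog w], so their exponents add without any branch
    correction. The exponents 1 - k / n have mean 1 / 2. *)
Lemma prod_cpow_coprime (w : R[i]) n : (1 < n)%N ->
  \prod_(1 <= k < n.+1 | coprime k n) cpow w (1 - k%:R / n%:R)
  = cpow w (1 - 2^-1) ^+ totient n.
Proof.
move=> n1; have n0 : n%:R != 0 :> R[i] by rewrite pnatr_eq0 -lt0n ltnW.
have mean : \sum_(1 <= k < n.+1 | coprime k n) (1 - k%:R / n%:R)
    = (totient n)%:R * (1 - 2^-1) :> R[i].
  have := congr1 (GRing.natmul (1 : R[i])) (sum_coprime n1).
  rewrite -mul2n !natrM; set S := (\sum_(_ <= _ < _ | _) _)%N => ES.
  have eS : S%:R = (totient n)%:R * n%:R / 2 :> R[i] by rewrite -ES; field.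
  have e1 : \sum_(1 <= k < n.+1 | coprime k n) 1 = (totient n)%:R :> R[i].
    by rewrite -totient_sum1// natr_sum.
  rewrite sumrB -mulr_suml -natr_sum -/S eS e1.
  by field.
rewrite /cpow -cexp_sum -mulr_suml mean -mulrA mulr_natl.
exact: cexpMn.
Qed.

End CoprimeProducts.

Theorem theorem2p2 (R : realType) (tau : R[i]) (htau : 0 < complex.Im tau)
    (n : nat) (hn : (2 <= n)%N) :
  Pq tau n =
    qgamma tau 2^-1 ^+ totient n
    * qpoch (qexp tau 2^-1) (qexp tau 1) ^+ totient n
    / \prod_(d <- divisors n)
        ramanujan_f (- qexp tau d%:R^-1) ^ mobius (n %/ d)
  /\
  qgamma tau 2^-1 ^+ totient n
    * qpoch (qexp tau 2^-1) (qexp tau 1) ^+ totient n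
    / \prod_(d <- divisors n)
        ramanujan_f (- qexp tau d%:R^-1) ^ mobius (n %/ d)
  = half_pow (qgamma tau 2^-1) (totient n) / exp_half_Lambda tau n.
Proof.
have n0 : (0 < n)%N := ltnW hn.
split; last first.
  (* The second equality is pure algebra: the powers of the square root of 2 in [half_pow] and
     [exp_half_Lambda] cancel. *)
  have s0 : (Num.sqrt (2 : R))%:C ^+ totient n != 0.
    by rewrite expf_neq0// fmorph_eq0 sqrtr_eq0 -ltNge ltr0n.
  rewrite /half_pow /exp_half_Lambda; set A := \prod_(_ <- _) _.
  by rewrite -(mulrA _ A) invfM [RHS]mulrACA divff// mul1r invf_div mulrA.
have -> : \prod_(d <- divisors n) ramanujan_f (- qexp tau d%:R^-1) ^ mobius (n %/ d)
    = qpoch_coprime tau n.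
  apply: (prod_mobius_inversion n0) => d dn; have d0 := dvdn_gt0 n0 dn.
    exact: qpoch_coprime_neq0.
  exact: ramanujan_f_prod_divisors.
have h0 : qpoch (qexp tau 2^-1) (qexp tau 1) != 0.
  by have := qpoch_ratio_neq0 htau (ltn0Sn 0) (ltn0Sn 1); rewrite div1r.
pose q := qexp tau 1.
have gE z : qgamma tau z = qpoch q q / qpoch (qexp tau z) q * cpow (1 - q) (1 - z).
  by [].
(* The factor (q^(1/2); q)_oo cancels the denominator of Gamma_q (1/2), leaving (q; q)_oo (1 -
   q)^(1/2) to the power phi (n). *)
have -> : qgamma tau 2^-1 ^+ totient n * qpoch (qexp tau 2^-1) q ^+ totient n
    = qpoch q q ^+ totient n * cpow (1 - q) (1 - 2^-1) ^+ totient n.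
  by rewrite -!exprMn gE mulrAC divfK.
rewrite /Pq; under eq_bigr do rewrite gE.
rewrite big_split /= prod_cpow_coprime// [RHS]mulrAC; congr (_ * _).
rewrite prodf_div -totient_sum1//; congr (_ / _).
by rewrite -prodrXr; apply: eq_bigr => k _; rewrite expr1.
Qed.
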